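(* Let $\mu:A^M\to\mathbb{C}$ be a smooth function from an open subset $A^M$ of Minkowski space $\mathbb{M}^4$ which represents a shear-free ray congruence, i.e., satisfies $$\Bigl(\frac{\partial}{\partial v}+i\mu\frac{\partial}{\partial q_2}\Bigr)\mu=0,\qquad \Bigl(\frac{\partial}{\partial\overline{q}_2}-i\mu\frac{\partial}{\partial w}\Bigr)\mu=0 .$$ Then $\mu$ is a harmonic morphism.
   Context: $\mathbb{M}^4=\{(t,x_1,x_2,x_3)\}$ with metric $-dt^2+dx_1^2+dx_2^2+dx_3^2$; $v=x_1+t$, $w=x_1-t$, $q_2=x_2+ix_3$, with $\partial/\partial q_2=\frac12(\partial/\partial x_2-i\,\partial/\partial x_3)$, $\partial/\partial\overline{q}_2=\frac12(\partial/\partial x_2+i\,\partial/\partial x_3)$, $\partial/\partial v=\frac12(\partial/\partial x_1+\partial/\partial t)$, $\partial/\partial w=\frac12(\partial/\partial x_1-\partial/\partial t)$. The function $\mu$ represents the distribution of null directions spanned by $\partial/\partial t+U$, where $U=\sigma^{-1}(i\mu)$ and $\sigma^{-1}(u)=\frac{1}{1+|u|^2}(1-|u|^2,2\,\mathrm{Re}\,u,2\,\mathrm{Im}\,u)\in S^2$ is inverse stereographic projection; the displayed equations are the condition that the integral curves of this distribution form a shear-free ray congruence. A smooth function $\phi:A^M\to\mathbb{C}$ is a harmonic morphism if its composition with every locally defined harmonic function on $\mathbb{C}$ is harmonic (satisfies the wave equation); equivalently, $-\phi_{tt}+\phi_{x_1x_1}+\phi_{x_2x_2}+\phi_{x_3x_3}=0$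 and $-\phi_t^2+\phi_{x_1}^2+\phi_{x_2}^2+\phi_{x_3}^2=0$. *)

(* Defs.v *)
(* Stdlib reals with Coquelicot. *)
From Stdlib Require Import Reals List.
From Coquelicot Require Import Coquelicot.
Import ListNotations.
Open Scope R_scope.

(* Functions on an open set A are represented by total functions of which only
   the values on A are used: [Derive] at a point of A depends only on the germ
   of the function there. *)

Definition Ddir {V : NormedModule R_AbsRing} (e : V) (f : V -> R) (p : V) : R :=
  Derive (fun s : R => f (plus p (scal s e))) 0.

Definition ex_Ddir {V : NormedModule R_AbsRing} (e : V) (f : V -> R) (p : V) :
  Prop :=
  ex_derive (fun s : R => f (plus p (scal s e))) 0.

(* With B the standard basis: all iterated partial derivatives of f of order at
   most k exist and are continuous on A. *)
Fixpoint Ck_on {V : NormedModule R_AbsRing} (B : list V) (k : nat)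
    (A : V -> Prop) (f : V -> R) : Prop :=
  (forall p, A p -> continuous f p) /\
  match k with
  | O => True
  | S k' => forall e, In e B ->
      (forall p, A p -> ex_Ddir e f p) /\ Ck_on B k' A (Ddir e f)
  end.

(* Points of Minkowski space are (t, x1, x2, x3). *)
Definition M4 : NormedModule R_AbsRing :=
  prod_NormedModule R_AbsRing
    (prod_NormedModule R_AbsRing
      (prod_NormedModule R_AbsRing R_NormedModule R_NormedModule)
      R_NormedModule)
    R_NormedModule.

Definition e_t : M4 := (1, 0, 0, 0).
Definition e_x1 : M4 := (0, 1, 0, 0).
Definition e_x2 : M4 := (0, 0, 1, 0).
Definition e_x3 : M4 := (0, 0, 0, 1).
Definition M4_basis : list M4 := [e_t; e_x1; e_x2; e_x3].

Definition C_re : C_R_NormedModule := (1, 0).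
Definition C_im : C_R_NormedModule := (0, 1).
Definition C_basis : list C_R_NormedModule := [C_re; C_im].

Definition smooth_on (A : M4 -> Prop) (phi : M4 -> C) : Prop :=
  forall k : nat,
    Ck_on M4_basis k A (fun p => Re (phi p)) /\
    Ck_on M4_basis k A (fun p => Im (phi p)).

Definition CDdir (e : M4) (phi : M4 -> C) (p : M4) : C :=
  (Ddir e (fun q => Re (phi q)) p, Ddir e (fun q => Im (phi q)) p).

(* v = x1 + t, w = x1 - t, q2 = x2 + i x3. *)
Definition d_v (phi : M4 -> C) (p : M4) : C :=
  (/ 2 * (CDdir e_x1 phi p + CDdir e_t phi p))%C.
Definition d_w (phi : M4 -> C) (p : M4) : C :=
  (/ 2 * (CDdir e_x1 phi p - CDdir e_t phi p))%C.
Definition d_q2 (phi : M4 -> C) (p : M4) : C :=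
  (/ 2 * (CDdir e_x2 phi p - Ci * CDdir e_x3 phi p))%C.
Definition d_q2bar (phi : M4 -> C) (p : M4) : C :=
  (/ 2 * (CDdir e_x2 phi p + Ci * CDdir e_x3 phi p))%C.

(* The null directions represented by mu are those of d/dt + U, where
   U = sigma^-1 (i mu) and sigma^-1 is inverse stereographic projection; the
   equations say that their integral curves form a shear-free congruence. *)
Definition shear_free_ray_congruence (A : M4 -> Prop) (mu : M4 -> C) : Prop :=
  forall p, A p ->
    (d_v mu p + Ci * mu p * d_q2 mu p = 0)%C /\
    (d_q2bar mu p - Ci * mu p * d_w mu p = 0)%C.

Definition laplacian (f : C_R_NormedModule -> R) (z : C_R_NormedModule) : R :=
  Ddir C_re (Ddir C_re f) z + Ddir C_im (Ddir C_im f) z.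

Definition box (g : M4 -> R) (p : M4) : R :=
  - Ddir e_t (Ddir e_t g) p + Ddir e_x1 (Ddir e_x1 g) p
  + Ddir e_x2 (Ddir e_x2 g) p + Ddir e_x3 (Ddir e_x3 g) p.

Definition harmonic_on_C (V : C_R_NormedModule -> Prop)
    (f : C_R_NormedModule -> R) : Prop :=
  Ck_on C_basis 2 V f /\ forall z, V z -> laplacian f z = 0.

Definition harmonic_on_M4 (A : M4 -> Prop) (g : M4 -> R) : Prop :=
  Ck_on M4_basis 2 A g /\ forall p, A p -> box g p = 0.

Definition harmonic_morphism (A : M4 -> Prop) (phi : M4 -> C) : Prop :=
  smooth_on A phi /\
  forall (V : C_R_NormedModule -> Prop) (f : C_R_NormedModule -> R),
    open V -> harmonic_on_C V f ->
    harmonic_on_M4 (fun p => A p /\ V (phi p)) (fun p => f (phi p)).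

(* Main.v *)
(* In null coordinates the wave operator is 4 (d_v d_w + d_q2 d_q2bar).
   Substituting d_v mu = -i mu d_q2 mu and d_q2bar mu = i mu d_w mu, the squared
   gradient d_v mu d_w mu + d_q2 mu d_q2bar mu vanishes, and so does
   d_w (-i mu d_q2 mu) + d_q2 (i mu d_w mu), because second derivatives commute.
   By the chain rule, the wave operator applied to f o mu is a combination of
   the Laplacian of f at mu, the squared gradient of mu and its wave operator. *)

Require Import Defs.
From Stdlib Require Import Reals List Lra.
From Coquelicot Require Import Coquelicot.

(** * Calculus of directional derivatives along lines *)

Lemma line_0 {V : NormedModule R_AbsRing} (p e : V) :
  plus p (scal (0 : R) e) = p.
Proof.
  transitivity (plus p zero); [f_equal; exact (scal_zero_l e) | apply plus_zero_r].
Qed.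

Lemma continuous_line {V : NormedModule R_AbsRing} (p e : V) (s : R) :
  continuous (fun s : R => plus p (scal s e)) s.
Proof.
  apply (@continuous_plus _ R_AbsRing).
  - apply continuous_const.
  - apply (@continuous_scal_l _ R_AbsRing V (fun s : R => s) e s), continuous_id.
Qed.

(** The line is continuous and passes through [p] at parameter 0. This is why directional
    derivatives depend only on germs. *)
Lemma locally_line {V : NormedModule R_AbsRing} (A : V -> Prop) (p e : V) :
  locally p A -> locally (0 : R) (fun s : R => A (plus p (scal s e))).
Proof.
  intros HA.
  apply (continuous_line p e 0).
  now rewrite line_0.
Qed.

Lemma Ddir_ext_loc {V : NormedModule R_AbsRing} (e : V) (f g : V -> R) (p : V) :
  locally p (fun q => f q = g q) -> Ddir e f p = Ddir e g p.
Proof.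
  intros H; apply Derive_ext_loc, (locally_line (fun q => f q = g q)), H.
Qed.

Lemma ex_Ddir_ext_loc {V : NormedModule R_AbsRing} (e : V) (f g : V -> R)
    (p : V) :
  locally p (fun q => f q = g q) -> ex_Ddir e f p -> ex_Ddir e g p.
Proof.
  intros H; apply ex_derive_ext_loc, (locally_line (fun q => f q = g q)), H.
Qed.

Lemma ex_Ddir_plus {V : NormedModule R_AbsRing} (e : V) (f g : V -> R) (p : V) :
  ex_Ddir e f p -> ex_Ddir e g p -> ex_Ddir e (fun q => f q + g q) p.
Proof.
  intros Hf Hg; exact (@ex_derive_plus R_AbsRing R_NormedModule _ _ _ Hf Hg).
Qed.

Lemma Ddir_plus {V : NormedModule R_AbsRing} (e : V) (f g : V -> R) (p : V) :
  ex_Ddir e f p -> ex_Ddir e g p ->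
  Ddir e (fun q => f q + g q) p = Ddir e f p + Ddir e g p.
Proof. intros Hf Hg; exact (Derive_plus _ _ _ Hf Hg). Qed.

Lemma ex_Ddir_minus {V : NormedModule R_AbsRing} (e : V) (f g : V -> R) (p : V) :
  ex_Ddir e f p -> ex_Ddir e g p -> ex_Ddir e (fun q => f q - g q) p.
Proof.
  intros Hf Hg; exact (@ex_derive_minus R_AbsRing R_NormedModule _ _ _ Hf Hg).
Qed.

Lemma Ddir_minus {V : NormedModule R_AbsRing} (e : V) (f g : V -> R) (p : V) :
  ex_Ddir e f p -> ex_Ddir e g p ->
  Ddir e (fun q => f q - g q) p = Ddir e f p - Ddir e g p.
Proof. intros Hf Hg; exact (Derive_minus _ _ _ Hf Hg). Qed.

Lemma ex_Ddir_mult {V : NormedModule R_AbsRing} (e : V) (f g : V -> R) (p : V) :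
  ex_Ddir e f p -> ex_Ddir e g p -> ex_Ddir e (fun q => f q * g q) p.
Proof. intros Hf Hg; exact (ex_derive_mult _ _ _ Hf Hg). Qed.

Lemma Ddir_mult {V : NormedModule R_AbsRing} (e : V) (f g : V -> R) (p : V) :
  ex_Ddir e f p -> ex_Ddir e g p ->
  Ddir e (fun q => f q * g q) p = Ddir e f p * g p + f p * Ddir e g p.
Proof.
  intros Hf Hg; unfold Ddir.
  rewrite (Derive_mult _ _ _ Hf Hg).
  now rewrite line_0.
Qed.

(** Allows an equation valid on all of an open set to be differentiated: near [p] the function
    agrees with the constant 0. *)
Lemma Ddir_zero_on {V : NormedModule R_AbsRing} (A : V -> Prop) (e : V)
    (f : V -> R) (p : V) :
  open A -> (forall q, A q -> f q = 0) -> A p -> Ddir e f p = 0.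
Proof.
  intros HA Hf Hp.
  rewrite (Ddir_ext_loc e f (fun _ => 0)).
  - exact (Derive_const 0 0).
  - now apply (filter_imp A); [|apply HA].
Qed.

Lemma line_plus {V : NormedModule R_AbsRing} (p e : V) (s t : R) :
  plus p (scal (s + t) e) = plus (plus p (scal s e)) (scal t e).
Proof.
  rewrite <- plus_assoc; f_equal; apply (scal_distr_r s t e).
Qed.

(** [Ddir] differentiates at parameter 0 only. Moving the base point of the line to parameter [s]
    makes the difference quotients agree for every increment [h]. *)
Lemma Derive_line {V : NormedModule R_AbsRing} (e : V) (f : V -> R) (p : V)
    (s : R) :
  Derive (fun s : R => f (plus p (scal s e))) s
  = Ddir e f (plus p (scal s e)).
Proof.
  unfold Ddir, Derive; f_equal; apply Lim_ext; intros h.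
  now rewrite <- !line_plus, Rplus_0_l, Rplus_0_r.
Qed.

Lemma ex_derive_line {V : NormedModule R_AbsRing} (e : V) (f : V -> R) (p : V)
    (s : R) :
  ex_Ddir e f (plus p (scal s e)) ->
  ex_derive (fun s : R => f (plus p (scal s e))) s.
Proof.
  intros Hf.
  apply (ex_derive_ext
    (fun t : R => f (plus (plus p (scal s e)) (scal (t - s) e)))).
  { intros t; rewrite <- line_plus; do 3 f_equal; ring. }
  apply (ex_derive_comp (fun h : R => f (plus (plus p (scal s e)) (scal h e)))
           (fun t => t - s)).
  - now replace (s - s) with 0 by ring.
  - now auto_derive.
Qed.

Lemma is_derive_line {V : NormedModule R_AbsRing} (e : V) (f : V -> R) (p : V)
    (s : R) :
  ex_Ddir e f (plus p (scal s e)) ->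
  is_derive (fun s : R => f (plus p (scal s e))) s
    (Ddir e f (plus p (scal s e))).
Proof.
  intros Hf; rewrite <- Derive_line; now apply Derive_correct, ex_derive_line.
Qed.

(** * Functions of class C^k: closure properties and symmetry of second derivatives *)

Section Ck.
Context {V : NormedModule R_AbsRing} (B : list V).
Implicit Types (A : V -> Prop) (f g : V -> R).

Lemma Ck_on_continuous k A f p : Ck_on B k A f -> A p -> continuous f p.
Proof. destruct k; intros [H _]; apply H. Qed.

Lemma Ck_on_ex_Ddir k A f e p :
  In e B -> Ck_on B (S k) A f -> A p -> ex_Ddir e f p.
Proof. intros He [_ H]; apply (H e He). Qed.

Lemma Ck_on_Ddir k A f e : In e B -> Ck_on B (S k) A f -> Ck_on B k A (Ddir e f).
Proof. intros He [_ H]; apply (H e He). Qed.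

Lemma Ck_on_S k A f : Ck_on B (S k) A f -> Ck_on B k A f.
Proof.
  revert f; induction k as [|k IH]; intros f [Hc H].
  - now split.
  - split; [exact Hc|].
    intros e He; destruct (H e He) as [He1 He2].
    split; [exact He1 | exact (IH _ He2)].
Qed.

Lemma Ck_on_subset k A A' f :
  (forall p, A' p -> A p) -> Ck_on B k A f -> Ck_on B k A' f.
Proof.
  intros HA; revert f; induction k as [|k IH]; intros f [Hc H];
    (split; [intros p Hp; exact (Hc p (HA p Hp))|]); [exact I|].
  intros e He; destruct (H e He) as [He1 He2].
  split; [intros p Hp; exact (He1 p (HA p Hp)) | exact (IH _ He2)].
Qed.

(** Openness turns equality on [A] into equality of germs at each point, so the first derivatives
    agree on [A] too and the induction continues with them. *)
Lemma Ck_on_ext k A f g :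
  open A -> (forall p, A p -> f p = g p) -> Ck_on B k A f -> Ck_on B k A g.
Proof.
  intros HA; revert f g; induction k as [|k IH]; intros f g Hfg [Hc H].
  all: assert (Hl : forall p, A p -> locally p (fun q => f q = g q))
    by (intros p Hp; apply (filter_imp A); [apply Hfg | apply HA, Hp]).
  all: split;
    [intros p Hp; apply (continuous_ext_loc _ f); [now apply Hl | now apply Hc]|].
  - exact I.
  - intros e He; destruct (H e He) as [He1 He2]; split.
    + intros p Hp; exact (ex_Ddir_ext_loc e f g p (Hl p Hp) (He1 p Hp)).
    + apply (IH (Ddir e f)); [|exact He2].
      intros p Hp; now apply Ddir_ext_loc, Hl.
Qed.

Lemma Ck_on_plus k A f g :
  open A -> Ck_on B k A f -> Ck_on B k A g ->
  Ck_on B k A (fun p => f p + g p).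
Proof.
  intros HA; revert f g; induction k as [|k IH]; intros f g Hf Hg.
  all: split;
    [intros p Hp; apply (@continuous_plus _ R_AbsRing R_NormedModule);
      eapply Ck_on_continuous; eassumption|].
  - exact I.
  - intros e He; split.
    + intros p Hp; apply ex_Ddir_plus; eapply Ck_on_ex_Ddir; eassumption.
    + apply (Ck_on_ext _ _ (fun p => Ddir e f p + Ddir e g p) _ HA).
      * intros p Hp; symmetry.
        apply Ddir_plus; eapply Ck_on_ex_Ddir; eassumption.
      * apply IH; now apply Ck_on_Ddir.
Qed.

(** Induction on [k] for all pairs at once: the Leibniz formula is a sum of products of functions of
    class one lower, the undifferentiated factor being weakened by [Ck_on_S]. *)
Lemma Ck_on_mult k A f g :
  open A -> Ck_on B k A f -> Ck_on B k A g ->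
  Ck_on B k A (fun p => f p * g p).
Proof.
  intros HA; revert f g; induction k as [|k IH]; intros f g Hf Hg.
  all: split;
    [intros p Hp; apply (@continuous_mult _ R_AbsRing);
      eapply Ck_on_continuous; eassumption|].
  - exact I.
  - intros e He; split.
    + intros p Hp; apply ex_Ddir_mult; eapply Ck_on_ex_Ddir; eassumption.
    + apply (Ck_on_ext _ _ (fun p => Ddir e f p * g p + f p * Ddir e g p) _ HA).
      * intros p Hp; symmetry.
        apply Ddir_mult; eapply Ck_on_ex_Ddir; eassumption.
      * apply Ck_on_plus; [easy| |];
          apply IH; auto using Ck_on_Ddir, Ck_on_S.
Qed.

(** Schwarz's theorem in the plane, applied to the pullback [F] sending [(a, b)] to
    [f (p + a d + b e)], whose mixed partial derivatives are the iterated directional derivatives of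
    [f]. *)
Lemma Ddir_comm A f d e p :
  In d B -> In e B -> open A -> Ck_on B 2 A f -> A p ->
  Ddir d (Ddir e f) p = Ddir e (Ddir d f) p.
Proof.
  intros Hd He HA Hf Hp.
  set (P := fun a b : R => plus (plus p (scal a d)) (scal b e)).
  (* With the two displacements exchanged, [a] becomes the parameter of a line, so the lemmas on
     lines apply in either variable. *)
  assert (P' : forall a b, P a b = plus (plus p (scal b e)) (scal a d)).
  { intros a b; unfold P; rewrite <- !plus_assoc; f_equal; apply plus_comm. }
  assert (P0 : P 0 0 = p) by (unfold P; now rewrite !line_0).
  assert (HP : continuous (fun z : R * R => P (fst z) (snd z)) (0, 0)).
  { unfold P; apply (@continuous_plus _ R_AbsRing);
      [apply (@continuous_plus _ R_AbsRing); [apply continuous_const|]|].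
    - apply (@continuous_scal_l _ R_AbsRing V (fun z : R * R => fst z)).
      apply continuous_fst.
    - apply (@continuous_scal_l _ R_AbsRing V (fun z : R * R => snd z)).
      apply continuous_snd. }
  assert (HPA : locally_2d (fun a b => A (P a b)) 0 0).
  { apply locally_2d_locally, HP; simpl; rewrite P0; now apply HA. }
  assert (DP : forall g a b, Derive (fun z => g (P z b)) a = Ddir d g (P a b)).
  { intros g a b; rewrite P', <- Derive_line.
    apply Derive_ext; intros z; now rewrite P'. }
  assert (exP : forall g a b, ex_Ddir d g (P a b) ->
    ex_derive (fun z => g (P z b)) a).
  { intros g a b Hg; rewrite P' in Hg.
    apply (ex_derive_ext (fun z => g (plus (plus p (scal b e)) (scal z d)))).
    - intros z; now rewrite P'.
    - now apply ex_derive_line. }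
  assert (DPe : forall g a b, Derive (fun z => g (P a z)) b = Ddir e g (P a b))
    by (intros; apply Derive_line).
  assert (exPe : forall g a b, ex_Ddir e g (P a b) ->
    ex_derive (fun z => g (P a z)) b) by (intros; now apply ex_derive_line).
  assert (HPc : forall g, continuous g p ->
    continuity_2d_pt (fun a b => g (P a b)) 0 0).
  { intros g Hg; apply continuity_2d_pt_filterlim.
    rewrite <- P0 in Hg; exact (continuous_comp _ g (0, 0) HP Hg). }
  pose (F := fun a b => f (P a b)).
  assert (E1 : forall a b, Derive (fun z => Derive (fun t => F z t) b) a
    = Ddir d (Ddir e f) (P a b)).
  { intros a b; rewrite <- DP; apply Derive_ext; intros z; apply DPe. }
  assert (E2 : forall a b, Derive (fun z => Derive (fun t => F t z) a) b
    = Ddir e (Ddir d f) (P a b)).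
  { intros a b; rewrite <- DPe; apply Derive_ext; intros z; apply DP. }
  rewrite <- P0, <- E1, <- E2.
  apply Schwarz.
  (* The derivatives must exist on a whole square around the origin; [HPA] supplies one that [P]
     maps into [A]. *)
  - destruct HPA as [del HPA]; exists del; intros a b Ha Hb.
    specialize (HPA a b Ha Hb).
    repeat split.
    + apply exP; eapply Ck_on_ex_Ddir; eassumption.
    + apply exPe; eapply Ck_on_ex_Ddir; eassumption.
    + apply (ex_derive_ext (fun z => Ddir e f (P z b)));
        [intros z; symmetry; apply DPe|].
      apply exP; apply (Ck_on_ex_Ddir 0 A); auto using Ck_on_Ddir.
    + apply (ex_derive_ext (fun z => Ddir d f (P a z)));
        [intros z; symmetry; apply DP|].
      apply exPe; apply (Ck_on_ex_Ddir 0 A); auto using Ck_on_Ddir.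
  - apply (continuity_2d_pt_ext (fun a b => Ddir d (Ddir e f) (P a b)));
      [now intros; rewrite E1|].
    apply HPc, (Ck_on_continuous 0 A); auto using Ck_on_Ddir.
  - apply (continuity_2d_pt_ext (fun a b => Ddir e (Ddir d f) (P a b)));
      [now intros; rewrite E2|].
    apply HPc, (Ck_on_continuous 0 A); auto using Ck_on_Ddir.
Qed.

End Ck.

(** * Total differentiability of C^1 functions on the complex plane *)

Lemma line_C_re (a b : R) : plus ((0, b) : C_R_NormedModule) (scal a C_re) = (a, b).
Proof.
  apply injective_projections; unfold plus, scal, C_re; simpl;
    unfold plus, scal; simpl; unfold mult; simpl; ring.
Qed.

Lemma line_C_im (a b : R) : plus ((a, 0) : C_R_NormedModule) (scal b C_im) = (a, b).
Proof.
  apply injective_projections; unfold plus, scal, C_im; simpl;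
    unfold plus, scal; simpl; unfold mult; simpl; ring.
Qed.

(** The chain rule needs a total differential of [f]. It exists because the partial derivative along
    [C_re] exists near [z] and is continuous there, while the one along [C_im] exists at [z]. *)
Lemma filterdiff_C1 (O : C_R_NormedModule -> Prop) (f : C_R_NormedModule -> R)
    (z : C_R_NormedModule) :
  open O -> Ck_on C_basis 1 O f -> O z ->
  filterdiff f (locally z)
    (fun h => plus (scal (fst h) (Ddir C_re f z)) (scal (snd h) (Ddir C_im f z))).
Proof.
  intros HO Hf Hz; destruct z as [x y].
  apply (filterdiff_ext (fun u : C_R_NormedModule => f (fst u, snd u)));
    [now intros []|].
  assert (Hre : forall a b, O (a, b) ->
    is_derive (fun t : R => f (t, b)) a (Ddir C_re f (a, b))).
  { intros a b Hab.
    (* Basing the line at [(0, b)] makes its parameter the real coordinate itself. *)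
    apply (is_derive_ext
      (fun t : R => f (plus (0, b) (scal t C_re) : C_R_NormedModule))).
    { intros t; now rewrite line_C_re. }
    pose proof (is_derive_line C_re f (0, b) a) as H.
    rewrite line_C_re in H; apply H.
    eapply Ck_on_ex_Ddir; [|eassumption|easy]; now left. }
  assert (Him : forall a b, O (a, b) ->
    is_derive (fun t : R => f (a, t)) b (Ddir C_im f (a, b))).
  { intros a b Hab.
    apply (is_derive_ext
      (fun t : R => f (plus (a, 0) (scal t C_im) : C_R_NormedModule))).
    { intros t; now rewrite line_C_im. }
    pose proof (is_derive_line C_im f (a, 0) b) as H.
    rewrite line_C_im in H; apply H.
    eapply Ck_on_ex_Ddir; [|eassumption|easy]; right; now left. }
  apply (is_derive_filterdiff (fun a b => f (a, b)) x y
    (fun a b => Ddir C_re f (a, b))).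
  - destruct (HO _ Hz) as [eps Heps]; exists eps.
    intros [a b] Hab; exact (Hre a b (Heps _ Hab)).
  - now apply Him.
  - apply (continuous_ext (Ddir C_re f)); [now intros []|].
    apply (Ck_on_continuous C_basis 0 O); [|easy].
    apply Ck_on_Ddir; [now left | easy].
Qed.

(** * Chain rule, to first and second order, for a function on the plane composed with [phi] *)

Section Composition.
Context {V : NormedModule R_AbsRing} (B : list V).
Context (A : V -> Prop) (O : C_R_NormedModule -> Prop) (phi : V -> C).
Context (A_open : open A) (O_open : open O).
Let u p := Re (phi p).
Let v p := Im (phi p).
Let AO p := A p /\ O (phi p).

(** Along the line, [u] and [v] are functions of the single parameter [s], so this is the derivative
    of the totally differentiable [f] along a plane curve. *)
Lemma is_derive_comp_C1 (f : C_R_NormedModule -> R) (e : V) (p : V) :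
  Ck_on C_basis 1 O f -> O (phi p) -> ex_Ddir e u p -> ex_Ddir e v p ->
  is_derive (fun s : R => f (phi (plus p (scal s e)))) 0
    (Ddir C_re f (phi p) * Ddir e u p + Ddir C_im f (phi p) * Ddir e v p).
Proof.
  intros Hf Hp Hu Hv.
  apply (is_derive_ext
    (fun s : R => f (u (plus p (scal s e)), v (plus p (scal s e))))).
  { intros s; unfold u, v, Re, Im; now rewrite <- surjective_pairing. }
  assert (Hphi : phi p = (u (plus p (scal 0 e)), v (plus p (scal 0 e)))).
  { rewrite line_0; unfold u, v, Re, Im; apply surjective_pairing. }
  pose proof (filterdiff_C1 O f (phi p) O_open Hf Hp) as Df.
  set (a := Ddir C_re f (phi p)) in *; set (b := Ddir C_im f (phi p)) in *.
  (* The coefficients were named [a] and [b] beforehand, so only the base point of the differential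
     changes. *)
  rewrite Hphi in Df.
  apply Derive_correct in Hu; apply Derive_correct in Hv.
  eapply filterdiff_ext_lin.
  - apply (filterdiff_comp'_2 (fun s : R => u (plus p (scal s e)))
      (fun s : R => v (plus p (scal s e))) (fun x y => f (x, y))
      0 _ _ (fun x y => plus (scal x a) (scal y b)) Hu Hv).
    apply (filterdiff_ext f); [now intros [] | exact Df].
  - intros t; unfold Ddir, plus, scal; simpl; unfold mult; simpl; ring.
Qed.

Lemma ex_Ddir_comp (f : C_R_NormedModule -> R) (e : V) (p : V) :
  Ck_on C_basis 1 O f -> O (phi p) -> ex_Ddir e u p -> ex_Ddir e v p ->
  ex_Ddir e (fun q => f (phi q)) p.
Proof. intros; eexists; now apply is_derive_comp_C1. Qed.

Lemma Ddir_comp (f : C_R_NormedModule -> R) (e : V) (p : V) :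
  Ck_on C_basis 1 O f -> O (phi p) -> ex_Ddir e u p -> ex_Ddir e v p ->
  Ddir e (fun q => f (phi q)) p
  = Ddir C_re f (phi p) * Ddir e u p + Ddir C_im f (phi p) * Ddir e v p.
Proof. intros; now apply is_derive_unique, is_derive_comp_C1. Qed.

Context (u_Ck : forall k, Ck_on B k A u) (v_Ck : forall k, Ck_on B k A v).

Lemma continuous_of_Re_Im p : A p -> continuous (phi : V -> C_R_NormedModule) p.
Proof.
  intros Hp.
  apply (continuous_ext (fun q => (u q, v q))).
  { intros q; unfold u, v, Re, Im; now rewrite <- surjective_pairing. }
  apply (continuous_comp_2 u v (fun x y => (x, y))).
  - now apply (Ck_on_continuous B 0 A).
  - now apply (Ck_on_continuous B 0 A).
  - apply (continuous_ext (fun z => z)); [now intros []|apply continuous_id].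
Qed.

Lemma open_comp_domain : open AO.
Proof.
  intros p [Hp HO]; apply filter_and; [now apply A_open|].
  apply (continuous_of_Re_Im p Hp); now apply O_open.
Qed.

(** Induction on [k] for all [f]: by the chain rule the derivative is a sum of products of a partial
    derivative of [f] composed with [phi], covered by the induction hypothesis, and a derivative of
    [u] or [v]. *)
Lemma Ck_on_comp k (f : C_R_NormedModule -> R) :
  Ck_on C_basis k O f -> Ck_on B k AO (fun p => f (phi p)).
Proof.
  assert (AO_A : forall p, AO p -> A p) by (now intros p []).
  revert f; induction k as [|k IH]; intros f Hf.
  all: split; [intros p [Hp HO]; exact (continuous_comp phi f p
    (continuous_of_Re_Im p Hp) (Ck_on_continuous _ _ _ f _ Hf HO))|].
  - exact I.
  - assert (Hf1 : Ck_on C_basis 1 O f).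
    { clear - Hf; induction k as [|k IHk]; [easy|].
      now apply IHk, Ck_on_S. }
    intros e He; split.
    + intros p [Hp HO]; apply ex_Ddir_comp; try easy;
        eapply (Ck_on_ex_Ddir B 0); eauto.
    + apply (Ck_on_ext B _ _ (fun p => Ddir C_re f (phi p) * Ddir e u p
          + Ddir C_im f (phi p) * Ddir e v p) _ open_comp_domain).
      * intros p [Hp HO]; symmetry; apply Ddir_comp; try easy;
          eapply (Ck_on_ex_Ddir B 0); eauto.
      * apply Ck_on_plus; [apply open_comp_domain| |].
        all: apply Ck_on_mult; [apply open_comp_domain| |].
        -- apply IH, Ck_on_Ddir; [now left | easy].
        -- apply (Ck_on_subset B _ A); [easy|]; now apply Ck_on_Ddir.
        -- apply IH, Ck_on_Ddir; [right; now left | easy].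
        -- apply (Ck_on_subset B _ A); [easy|]; now apply Ck_on_Ddir.
Qed.

(** The two mixed derivatives of [f] form one coefficient. In the wave operator it multiplies the
    Minkowski product of the gradients of [u] and [v]. *)
Lemma Ddir2_comp (f : C_R_NormedModule -> R) (e : V) (p : V) :
  In e B -> Ck_on C_basis 2 O f -> AO p ->
  Ddir e (Ddir e (fun q => f (phi q))) p
  = Ddir C_re (Ddir C_re f) (phi p) * (Ddir e u p * Ddir e u p)
    + (Ddir C_im (Ddir C_re f) (phi p) + Ddir C_re (Ddir C_im f) (phi p))
      * (Ddir e u p * Ddir e v p)
    + Ddir C_im (Ddir C_im f) (phi p) * (Ddir e v p * Ddir e v p)
    + Ddir C_re f (phi p) * Ddir e (Ddir e u) p
    + Ddir C_im f (phi p) * Ddir e (Ddir e v) p.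
Proof.
  intros He Hf Hp.
  assert (Hf1 : Ck_on C_basis 1 O f) by now apply Ck_on_S.
  assert (Hre : Ck_on C_basis 1 O (Ddir C_re f))
    by (apply Ck_on_Ddir; [now left | easy]).
  assert (Him : Ck_on C_basis 1 O (Ddir C_im f))
    by (apply Ck_on_Ddir; [right; now left | easy]).
  assert (Hu : forall q, A q -> ex_Ddir e u q)
    by (intros; eapply (Ck_on_ex_Ddir B 0); eauto).
  assert (Hv : forall q, A q -> ex_Ddir e v q)
    by (intros; eapply (Ck_on_ex_Ddir B 0); eauto).
  assert (Hu2 : ex_Ddir e (Ddir e u) p).
  { apply (Ck_on_ex_Ddir B 0 A); [easy | now apply Ck_on_Ddir | apply Hp]. }
  assert (Hv2 : ex_Ddir e (Ddir e v) p).
  { apply (Ck_on_ex_Ddir B 0 A); [easy | now apply Ck_on_Ddir | apply Hp]. }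
  (* The first-order formula holds on the open set [AO], so it may be differentiated again at
     [p]. *)
  rewrite (Ddir_ext_loc e _ (fun q => Ddir C_re f (phi q) * Ddir e u q
          + Ddir C_im f (phi q) * Ddir e v q)).
  2: { apply (filter_imp AO); [|now apply open_comp_domain].
       intros q [Hq HO]; now apply Ddir_comp; auto. }
  destruct Hp as [Hp HO].
  assert (Xre : ex_Ddir e (fun q => Ddir C_re f (phi q)) p)
    by (apply ex_Ddir_comp; auto).
  assert (Xim : ex_Ddir e (fun q => Ddir C_im f (phi q)) p)
    by (apply ex_Ddir_comp; auto).
  rewrite Ddir_plus by (apply ex_Ddir_mult; auto).
  rewrite !Ddir_mult by auto.
  rewrite !Ddir_comp by auto.
  ring.
Qed.

End Composition.

Ltac solve_ex_Ddir :=
  lazymatch goal with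
  | |- ex_Ddir _ (fun q => _ + _) _ => apply ex_Ddir_plus; solve_ex_Ddir
  | |- ex_Ddir _ (fun q => _ - _) _ => apply ex_Ddir_minus; solve_ex_Ddir
  | |- ex_Ddir _ (fun q => _ * _) _ => apply ex_Ddir_mult; solve_ex_Ddir
  | |- _ => now auto
  end.

(* [lra] compares atoms syntactically, so eta-redexes must not be left behind. *)
Ltac eta_reduce f := lazymatch f with fun q => ?h q => h | _ => f end.

(** Expands the derivative of a polynomial expression until only derivatives of its atoms remain,
    leaving [H] linear in monomials. *)
Ltac push_Ddir H :=
  repeat match type of H with
  | context [Ddir ?e (fun q => @?f q + @?g q) ?p] =>
      let f := eta_reduce f in let g := eta_reduce g in
      rewrite (Ddir_plus e f g p) in H by (cbv beta; solve_ex_Ddir)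
  | context [Ddir ?e (fun q => @?f q - @?g q) ?p] =>
      let f := eta_reduce f in let g := eta_reduce g in
      rewrite (Ddir_minus e f g p) in H by (cbv beta; solve_ex_Ddir)
  | context [Ddir ?e (fun q => @?f q * @?g q) ?p] =>
      let f := eta_reduce f in let g := eta_reduce g in
      rewrite (Ddir_mult e f g p) in H by (cbv beta; solve_ex_Ddir)
  end.

(** * Consequences of the shear-free equations: wave equation and isotropic gradient *)

Section ShearFree.
Context (A : M4 -> Prop) (mu : M4 -> C).
Context (A_open : open A) (mu_smooth : smooth_on A mu).
Context (mu_sfr : shear_free_ray_congruence A mu).
Let u p := Re (mu p).
Let v p := Im (mu p).

(** Real and imaginary parts of the two complex equations, doubled to clear the factors 1/2. *)
Lemma shear_free_Re_Im p : A p ->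
  Ddir e_x1 u p + Ddir e_t u p + u p * (Ddir e_x3 u p - Ddir e_x2 v p)
    - v p * (Ddir e_x3 v p + Ddir e_x2 u p) = 0 /\
  Ddir e_x1 v p + Ddir e_t v p + u p * (Ddir e_x3 v p + Ddir e_x2 u p)
    + v p * (Ddir e_x3 u p - Ddir e_x2 v p) = 0 /\
  Ddir e_x2 u p - Ddir e_x3 v p + u p * (Ddir e_x1 v p - Ddir e_t v p)
    + v p * (Ddir e_x1 u p - Ddir e_t u p) = 0 /\
  Ddir e_x2 v p + Ddir e_x3 u p - u p * (Ddir e_x1 u p - Ddir e_t u p)
    + v p * (Ddir e_x1 v p - Ddir e_t v p) = 0.
Proof.
  intros Hp; destruct (mu_sfr p Hp) as [H1 H2].
  assert (E1 : (CDdir e_x1 mu p + CDdir e_t mu p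
    + Ci * mu p * (CDdir e_x2 mu p - Ci * CDdir e_x3 mu p) = 0)%C).
  { transitivity (2 * (d_v mu p + Ci * mu p * d_q2 mu p))%C.
    - unfold d_v, d_q2; field; apply RtoC_neq; lra.
    - rewrite H1; ring. }
  assert (E2 : (CDdir e_x2 mu p + Ci * CDdir e_x3 mu p
    - Ci * mu p * (CDdir e_x1 mu p - CDdir e_t mu p) = 0)%C).
  { transitivity (2 * (d_q2bar mu p - Ci * mu p * d_w mu p))%C.
    - unfold d_w, d_q2bar; field; apply RtoC_neq; lra.
    - rewrite H2; ring. }
  pose proof (f_equal Re E1) as R1; pose proof (f_equal Im E1) as I1.
  pose proof (f_equal Re E2) as R2; pose proof (f_equal Im E2) as I2.
  clear H1 H2 E1 E2.
  unfold CDdir, Re, Im in R1, I1, R2, I2; simpl in R1, I1, R2, I2.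
  change (fun q => fst (mu q)) with u in R1, I1, R2, I2.
  change (fun q => snd (mu q)) with v in R1, I1, R2, I2.
  change (fst (mu p)) with (u p) in R1, I1, R2, I2.
  change (snd (mu p)) with (v p) in R1, I1, R2, I2.
  lra.
Qed.

Lemma M4_basis_In :
  (In e_t M4_basis /\ In e_x1 M4_basis) /\ In e_x2 M4_basis /\ In e_x3 M4_basis.
Proof. unfold M4_basis; simpl; tauto. Qed.

Lemma box_shear_free p : A p -> box u p = 0 /\ box v p = 0.
Proof.
  intros Hp.
  destruct M4_basis_In as [[Bt B1] [B2 B3]].
  assert (Cu : forall k, Ck_on M4_basis k A u) by (intros k; apply (mu_smooth k)).
  assert (Cv : forall k, Ck_on M4_basis k A v) by (intros k; apply (mu_smooth k)).
  assert (du : forall e, In e M4_basis -> ex_Ddir e u p)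
    by (intros; now apply (Ck_on_ex_Ddir M4_basis 0 A)).
  assert (dv : forall e, In e M4_basis -> ex_Ddir e v p)
    by (intros; now apply (Ck_on_ex_Ddir M4_basis 0 A)).
  assert (ddu : forall d e, In d M4_basis -> In e M4_basis ->
      ex_Ddir d (Ddir e u) p)
    by (intros; apply (Ck_on_ex_Ddir M4_basis 0 A); auto using Ck_on_Ddir).
  assert (ddv : forall d e, In d M4_basis -> In e M4_basis ->
      ex_Ddir d (Ddir e v) p)
    by (intros; apply (Ck_on_ex_Ddir M4_basis 0 A); auto using Ck_on_Ddir).
  assert (Su : forall d e, In d M4_basis -> In e M4_basis ->
      Ddir d (Ddir e u) p = Ddir e (Ddir d u) p)
    by (intros; now apply (Ddir_comm M4_basis A)).
  assert (Sv : forall d e, In d M4_basis -> In e M4_basis ->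
      Ddir d (Ddir e v) p = Ddir e (Ddir d v) p)
    by (intros; now apply (Ddir_comm M4_basis A)).
  pose proof shear_free_Re_Im as E.
  assert (Z : forall e f, (forall q, A q -> f q = 0) -> Ddir e f p = 0)
    by (intros e f Hf; now apply (Ddir_zero_on A)).
  pose proof (Z e_x1 _ (fun q Hq => proj1 (E q Hq))) as F1.
  pose proof (Z e_t _ (fun q Hq => proj1 (E q Hq))) as F2.
  pose proof (Z e_x1 _ (fun q Hq => proj1 (proj2 (E q Hq)))) as F3.
  pose proof (Z e_t _ (fun q Hq => proj1 (proj2 (E q Hq)))) as F4.
  pose proof (Z e_x2 _ (fun q Hq => proj1 (proj2 (proj2 (E q Hq))))) as F5.
  pose proof (Z e_x3 _ (fun q Hq => proj1 (proj2 (proj2 (E q Hq))))) as F6.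
  pose proof (Z e_x2 _ (fun q Hq => proj2 (proj2 (proj2 (E q Hq))))) as F7.
  pose proof (Z e_x3 _ (fun q Hq => proj2 (proj2 (proj2 (E q Hq))))) as F8.
  clear E Z; cbv beta in *; clearbody u v.
  push_Ddir F1; push_Ddir F2; push_Ddir F3; push_Ddir F4.
  push_Ddir F5; push_Ddir F6; push_Ddir F7; push_Ddir F8.
  revert F1 F2 F3 F4 F5 F6 F7 F8.
  (* Each mixed derivative is normalised so that the earlier basis direction is outermost; [lra]
     then sees a single atom for it. *)
  rewrite ?(Su _ _ B1 Bt), ?(Su _ _ B2 Bt), ?(Su _ _ B3 Bt),
    ?(Su _ _ B2 B1), ?(Su _ _ B3 B1), ?(Su _ _ B3 B2),
    ?(Sv _ _ B1 Bt), ?(Sv _ _ B2 Bt), ?(Sv _ _ B3 Bt),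
    ?(Sv _ _ B2 B1), ?(Sv _ _ B3 B1), ?(Sv _ _ B3 B2).
  (* Applying [d_x1 - d_t] to the first complex equation and [d_x2 - i d_x3] to the second, then
     adding, cancels all quadratic and cubic-free remainders: [box u] is [F1 - F2 + F5 + F8] and
     [box v] is [F3 - F4 + F7 - F6]. *)
  intros; unfold box; split; lra.
Qed.

Lemma shear_free_conformal p : A p ->
  - (Ddir e_t u p * Ddir e_t u p) + Ddir e_x1 u p * Ddir e_x1 u p
    + Ddir e_x2 u p * Ddir e_x2 u p + Ddir e_x3 u p * Ddir e_x3 u p
  = - (Ddir e_t v p * Ddir e_t v p) + Ddir e_x1 v p * Ddir e_x1 v p
    + Ddir e_x2 v p * Ddir e_x2 v p + Ddir e_x3 v p * Ddir e_x3 v p /\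
  - (Ddir e_t u p * Ddir e_t v p) + Ddir e_x1 u p * Ddir e_x1 v p
    + Ddir e_x2 u p * Ddir e_x2 v p + Ddir e_x3 u p * Ddir e_x3 v p = 0.
Proof.
  intros Hp; destruct (shear_free_Re_Im p Hp) as [E1 [E2 [E3 E4]]].
  set (ut := Ddir e_t u p) in *; set (u1 := Ddir e_x1 u p) in *.
  set (u2 := Ddir e_x2 u p) in *; set (u3 := Ddir e_x3 u p) in *.
  set (vt := Ddir e_t v p) in *; set (v1 := Ddir e_x1 v p) in *.
  set (v2 := Ddir e_x2 v p) in *; set (v3 := Ddir e_x3 v p) in *.
  clearbody ut u1 u2 u3 vt v1 v2 v3.
  (* The two claims are the real and imaginary parts of
     (mu_1 + mu_t) (mu_1 - mu_t) + (mu_2 + i mu_3) (mu_2 - i mu_3) = 0, and each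
     equation is multiplied by the second factor of its product. *)
  apply (f_equal (Rmult (u1 - ut))) in E1 as R1.
  apply (f_equal (Rmult (v1 - vt))) in E1 as I1.
  apply (f_equal (Rmult (v1 - vt))) in E2 as R2.
  apply (f_equal (Rmult (u1 - ut))) in E2 as I2.
  apply (f_equal (Rmult (u2 + v3))) in E3 as R3.
  apply (f_equal (Rmult (v2 - u3))) in E3 as I3.
  apply (f_equal (Rmult (v2 - u3))) in E4 as R4.
  apply (f_equal (Rmult (u2 + v3))) in E4 as I4.
  (* [R1 - R2 + R3 - R4] gives the first claim, and [I1 + I2 + I3 + I4] is twice the second. *)
  split; lra.
Qed.

End ShearFree.

Theorem propositionS6p4 (A : M4 -> Prop) (mu : M4 -> C)
  (A_open : open A)
  (mu_smooth : smooth_on A mu)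
  (mu_sfr : shear_free_ray_congruence A mu) :
  harmonic_morphism A mu.
Proof.
  assert (Cu : forall k, Ck_on M4_basis k A (fun p => Re (mu p)))
    by (intros k; apply (mu_smooth k)).
  assert (Cv : forall k, Ck_on M4_basis k A (fun p => Im (mu p)))
    by (intros k; apply (mu_smooth k)).
  split; [exact mu_smooth|].
  intros V f V_open [Hf Hlap]; split.
  - exact (Ck_on_comp M4_basis A V mu A_open V_open Cu Cv 2 f Hf).
  - intros p Hp.
    destruct M4_basis_In as [[Bt B1] [B2 B3]].
    pose proof (fun e He =>
      Ddir2_comp M4_basis A V mu A_open V_open Cu Cv f e p He Hf Hp) as H.
    unfold box; rewrite (H _ Bt), (H _ B1), (H _ B2), (H _ B3); clear H.
    destruct Hp as [Hp HV]; specialize (Hlap _ HV); unfold laplacian in Hlap.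
    destruct (box_shear_free A mu A_open mu_smooth mu_sfr p Hp) as [Bu Bv].
    destruct (shear_free_conformal A mu mu_sfr p Hp) as [N O].
    unfold box in Bu, Bv.
    (* Each vanishing quantity is multiplied by its coefficient in the expanded wave operator, so
       that the goal follows linearly. *)
    apply (f_equal (Rmult (Ddir C_re f (mu p)))) in Bu.
    apply (f_equal (Rmult (Ddir C_im f (mu p)))) in Bv.
    apply (f_equal (Rmult (Ddir C_re (Ddir C_re f) (mu p)))) in N.
    apply (f_equal (Rmult (Ddir C_im (Ddir C_re f) (mu p)
      + Ddir C_re (Ddir C_im f) (mu p)))) in O.
    (* Harmonicity of [f] merges the two squared-gradient terms into one multiple of their
       difference, which [N] makes zero. *)
    replace (Ddir C_im (Ddir C_im f) (mu p))
      with (- Ddir C_re (Ddir C_re f) (mu p)) by lra.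
    clear Hlap; lra.
Qed.
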